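(* Let $X_N\subset\mathbb{S}^2$ be a spherical $k$-design with $k\ge 2r$, let $\alpha=\frac{N}{4\pi}$, and let $X_M\subset X_N$ be an interpolation subset satisfying $\operatorname{rank}(V_{M,r})=M$, where $V_{M,r}\in\mathbb{R}^{M\times R}$ is the Vandermonde matrix at $X_M$ of the basis of real spherical harmonics of $\Pi_r(\mathbb{S}^2)$. Let $$\sigma_1(V_{M,r})\ge\sigma_2(V_{M,r})\ge\cdots\ge\sigma_M(V_{M,r})>0$$ be the singular values of $V_{M,r}$, with $\sigma_{\max}(V_{M,r})=\sigma_1(V_{M,r})$ and $\sigma_{\min}(V_{M,r})=\sigma_M(V_{M,r})$, and let $S=\frac1\alpha V_{M,r}V_{M,r}^\top$. Then the following statements hold. (i) The spectrum of the KKT matrix $$\mathcal{K}=\begin{bmatrix}\alpha I & V_{M,r}^\top\\ V_{M,r} & 0\end{bmatrix}$$ is given (with multiplicities) by $$\operatorname{spec}(\mathcal{K})=\{\alpha\}^{R-M}\cup\{\lambda_j^+,\lambda_j^-: j=1,\dots,M\},$$ where $$\lambda_j^\pm=\frac{\alpha\pm\sqrt{\alpha^2+4\alpha\mu_j}}{2},\qquad j=1,\dots,M,$$ and $\mu_j$, $j=1,\dots,M$, are the eigenvalues of $S$. In particular, $\lambda_j^+>0$ and $\lambda_j^-<0$ for any $j=1,\dots,M$. (ii) The singular values of $\mathcal{K}$ are $$\{\alpha\}^{R-M}\cup\left\{\frac{\alpha+\sqrt{\alpha^2+4\sigma_j(V_{M,r})^2}}{2},\ \frac{\sqrt{\alpha^2+4\sigma_j(V_{M,r})^2}-\alpha}{2}: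 j=1,\dots,M\right\}.$$ (iii) The spectral condition number of $\mathcal{K}$ is $$\kappa_2(\mathcal{K})=\frac{\dfrac{\alpha+\sqrt{\alpha^2+4\sigma_{\max}(V_{M,r})^2}}{2}}{\min\left\{\alpha,\ \dfrac{\sqrt{\alpha^2+4\sigma_{\min}(V_{M,r})^2}-\alpha}{2}\right\}}.$$
   Context: $\mathbb{S}^2$ is the unit sphere in $\mathbb{R}^3$, $d\omega=\sin\varphi\,d\varphi\,d\theta$ its surface measure, $\Pi_k(\mathbb{S}^2)$ the space of spherical polynomials of degree at most $k$; $R=\dim\Pi_r(\mathbb{S}^2)=(r+1)^2$. $X_N$ consists of $N$ distinct nodes $\boldsymbol{x}_1,\dots,\boldsymbol{x}_N$ and $X_M$ of $M$ distinct nodes. Conventions: $N=(n+1)^2$, $M=(m+1)^2$, with integers $0\le m<r<n$ (so $M<R$). A finite set $X_N\subset\mathbb{S}^2$ is a spherical $k$-design if $\frac1N\sum_{i=1}^N p(\boldsymbol{x}_i)=\frac1{4\pi}\int_{\mathbb{S}^2}p\,d\omega$ for all $p\in\Pi_k(\mathbb{S}^2)$. $\{\alpha\}^{R-M}$ denotes the value $\alpha$ listed with multiplicity $R-M$ (lists are unions as multisets). $\kappa_2$ is the ratio of the largest to the smallest singular value. Real spherical harmonics $u_{\ell,m}$, $0\le\ell\le r$, $-\ell\le m\le\ell$, in spherical coordinates $(\varphi,\theta)\in[0,\pi]\times[0,2\pi)$: $u_{\ell,m}=\sqrt2\,N_{\ell,m}P_\ell^m(\cos\varphi)\cos(m\theta)$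 for $1\le m\le\ell$; $u_{\ell,0}=N_{\ell,0}P_\ell^0(\cos\varphi)$; $u_{\ell,m}=\sqrt2\,N_{\ell,|m|}P_\ell^{|m|}(\cos\varphi)\sin(|m|\theta)$ for $-\ell\le m\le-1$, where $P_\ell^m$ is the associated Legendre function and $N_{\ell,m}=\sqrt{\frac{2\ell+1}{4\pi}\frac{(\ell-m)!}{(\ell+m)!}}$. They form an $L^2(\mathbb{S}^2)$-orthonormal basis of $\Pi_r(\mathbb{S}^2)$. (Here the index $m$ of $u_{\ell,m}$ is unrelated to the $m$ in $M=(m+1)^2$.) In this setting $V_{N,r}^\top V_{N,r}=\alpha I$, where $V_{N,r}$ is the Vandermonde matrix at $X_N$, so $\mathcal{K}$ is the KKT matrix of the constrained least squares problem $\min_{\boldsymbol c}\|V_{N,r}\boldsymbol c-\boldsymbol f_N\|_2^2$ subject to $V_{M,r}\boldsymbol c=\boldsymbol f_M$. *)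

(* Defs.v *)
From HB Require Import structures.
From mathcomp Require Import all_boot all_order all_algebra.
From mathcomp Require Import all_classical all_reals all_analysis.
(* The notations of mpoly clash with those of MathComp-Analysis. *)
From mathcomp.multinomials Require Import -(notations) mpoly.
Set Implicit Arguments.
Unset Strict Implicit.
Unset Printing Implicit Defensive.
Import Order.TTheory GRing.Theory Num.Theory.
Import numFieldNormedType.Exports.
Local Open Scope classical_set_scope.
Local Open Scope ring_scope.

Section Sphere.
Variable R : realType.

Definition sphere2 : set 'rV[R]_3 := [set x | \sum_(i < 3) x 0 i ^+ 2 = 1].

(* phi is the polar angle (colatitude), theta the azimuth. *)
Definition sph_point (phi theta : R) : 'rV[R]_3 :=
  \row_(i < 3) [:: sin phi * cos theta; sin phi * sin theta; cos phi]`_i.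

(* At the poles theta is not unique and an arbitrary admissible value is
   chosen; the spherical harmonics below do not depend on that choice, because
   P_l^m(1) = P_l^m(-1) = 0 for m > 0. *)
Definition sph_coord (x : 'rV[R]_3) : R * R :=
  xget (0, 0) [set p : R * R | [/\ 0 <= p.1 <= pi, 0 <= p.2 < 2 * pi
                                 & sph_point p.1 p.2 = x]].

Definition sphere_integral (f : 'rV[R]_3 -> R) : R :=
  Rintegral lebesgue_measure `[0, 2 * pi] (fun theta : R =>
    Rintegral lebesgue_measure `[0, pi] (fun phi : R =>
      f (sph_point phi theta) * sin phi)).

(* The elements of Pi_k(S^2) are the restrictions to the sphere of the
   polynomials in three variables of total degree at most k (the size [msize]
   is the total degree plus one). *)
Definition spherical_design (k N : nat) (x : 'I_N -> 'rV[R]_3) : Prop :=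
  forall p : mpoly 3 R, (mmeasure mdeg p <= k.+1)%N ->
    N%:R^-1 * \sum_(i < N) meval (x i 0) p =
    (4 * pi)^-1 * sphere_integral (fun y => meval (y 0) p).

(* Rodrigues' formula. *)
Definition legendre (l : nat) : {poly R} :=
  ((2 ^ l * l`!)%N%:R)^-1 *: (('X^2 - 1) ^+ l)^`(l).

(* Without the Condon-Shortley phase (-1)^m. *)
Definition assoc_legendre (l m : nat) (t : R) : R :=
  Num.sqrt (1 - t ^+ 2) ^+ m * ((legendre l)^`(m)).[t].

Definition sph_norm (l m : nat) : R :=
  Num.sqrt ((l.*2.+1)%:R / (4 * pi) * ((l - m)`!%:R / (l + m)`!%:R)).

Definition sph_harm_coord (l : nat) (m : int) (phi theta : R) : R :=
  let a := `|m|%N in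
  if m == 0 then sph_norm l 0 * assoc_legendre l 0 (cos phi)
  else if 0 < m then
    Num.sqrt 2 * sph_norm l a * assoc_legendre l a (cos phi)
      * cos (a%:R * theta)
  else
    Num.sqrt 2 * sph_norm l a * assoc_legendre l a (cos phi)
      * sin (a%:R * theta).

Definition sph_harm (lm : nat * int) (x : 'rV[R]_3) : R :=
  sph_harm_coord lm.1 lm.2 (sph_coord x).1 (sph_coord x).2.

End Sphere.

(* (0,0), (1,-1), (1,0), (1,1), (2,-2), ..., (r,r). *)
Definition sph_index (r : nat) : seq (nat * int) :=
  [seq (l, k%:Z - l%:Z) | l <- iota 0 r.+1, k <- iota 0 l.*2.+1].

Lemma size_sph_index r : size (sph_index r) = (r.+1 ^ 2)%N.
Proof.
rewrite /sph_index size_allpairs_dep sumnE big_map -[iota 0 r.+1]/(index_iota 0 r.+1).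
elim: r => [|r IH]; first by rewrite big_nat1.
rewrite big_nat_recr //= {}IH size_iota -[in RHS](addn1 r.+1) sqrnD exp1n.
by rewrite muln1 mul2n -addnA add1n.
Qed.

Definition vandermonde (R : realType) (r K : nat) (x : 'I_K -> 'rV[R]_3) :
    'M[R]_(K, r.+1 ^ 2) :=
  \matrix_(i, j) sph_harm (nth (0%N, 0) (sph_index r) j) (x i).

Section Spectra.
Variable R : realType.

(* The eigenvalues of a real square matrix whose characteristic polynomial
   splits over R (e.g. a symmetric one), repeated according to multiplicity and
   in nonincreasing order. The value is the empty list for other matrices. *)
Definition eigvals n (A : 'M[R]_n) : seq R :=
  xget [::] [set s : seq R | sorted (fun a b => b <= a) s /\
                             char_poly A = \prod_(a <- s) ('X - a%:P)].

(* sigma_1 >= ... >= sigma_min(m,n), stored from index 0. *)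
Definition singvals m n (A : 'M[R]_(m, n)) : seq R :=
  take (minn m n) [seq Num.sqrt a | a <- eigvals (A^T *m A)].

Definition cond2 n (A : 'M[R]_n) : R :=
  head 0 (singvals A) / last 0 (singvals A).

(* The KKT matrix of min |W c - f|^2 subject to V c = g (first-order conditions
   W^T W c + V^T lambda = W^T f, V c = g) when W^T W = alpha I. *)
Definition kkt_mx m n (alpha : R) (V : 'M[R]_(m, n)) : 'M[R]_(n + m) :=
  block_mx alpha%:M V^T V 0.

End Spectra.

(* Main.v *)
(* Multiplying the block matrix [xI, B; C, yI] by a triangular one gives
   det [xI, B; C, yI] x^m = x^n det (xyI - CB), and symmetrically with y.
   For x = X - alpha and y = X this yields
   char_poly K = (X - alpha)^(n - m) prod_nu ((X - alpha) X - nu),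
   where nu runs over the eigenvalues of V V^T, which are the squares of the
   singular values of V. As K is symmetric, its singular values are the absolute
   values of its eigenvalues. *)

Require Import Defs.
From HB Require Import structures.
From mathcomp Require Import all_boot all_order all_algebra.
From mathcomp Require Import all_classical all_reals all_analysis.
From mathcomp.real_closed Require Import complex.
From mathcomp Require Import ring lra.
Import Order.TTheory GRing.Theory Num.Theory.
Import numFieldNormedType.Exports.
Local Open Scope classical_set_scope.
Local Open Scope ring_scope.

(** * Block determinants and characteristic polynomials *)

Lemma det_block_scalar_ul {P : comNzRingType} {n m} (x y : P)
    (B : 'M[P]_(n, m)) (C : 'M[P]_(m, n)) :
  \det (block_mx x%:M B C y%:M) * x ^+ m = x ^+ n * \det ((x * y)%:M - C *m B).
Proof.
(* Right multiplication by this factor clears the upper right block. Its determinant stays on the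
   left as [x ^+ m], so nothing is divided and the identity holds over polynomial rings. *)
have <- : \det (block_mx 1%:M (- B) 0 x%:M) = x ^+ m.
  by rewrite det_ublock det1 mul1r det_scalar.
rewrite -det_mulmx mulmx_block !mulmx1 !mulmx0 !addr0 mulmxN mul_scalar_mx.
rewrite mul_mx_scalar addNr -scalar_mxM mulmxN addrC (mulrC y).
by rewrite det_lblock det_scalar.
Qed.

Lemma det_block_scalar_dr {P : comNzRingType} {n m} (x y : P)
    (B : 'M[P]_(n, m)) (C : 'M[P]_(m, n)) :
  \det (block_mx x%:M B C y%:M) * y ^+ n = \det ((x * y)%:M - B *m C) * y ^+ m.
Proof.
have <- : \det (block_mx y%:M 0 (- C) 1%:M) = y ^+ n.
  by rewrite det_lblock det1 mulr1 det_scalar.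
rewrite -det_mulmx mulmx_block !mulmx1 !mulmx0 !add0r !mulmxN -scalar_mxM.
by rewrite mul_scalar_mx mul_mx_scalar addrN det_ublock det_scalar.
Qed.

Lemma char_poly_comp {P : comNzRingType} {n} (A : 'M[P]_n) (q : {poly P}) :
  char_poly A \Po q = \det (q%:M - map_mx polyC A).
Proof.
rewrite -det_map_mx; congr (\det _); apply/matrixP => i j.
by rewrite !mxE rmorphB rmorphMn /= comp_polyX comp_polyC.
Qed.

(** Both sides arise from one block determinant with diagonal blocks [1] and ['X], eliminated in the
    two possible ways. *)
Lemma char_poly_mulmxC {P : comNzRingType} {m n} (B : 'M[P]_(n, m))
    (C : 'M[P]_(m, n)) :
  char_poly (B *m C) * 'X^m = 'X^n * char_poly (C *m B).
Proof.
have := det_block_scalar_dr 1 'X (map_mx polyC B) (map_mx polyC C).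
have := det_block_scalar_ul 1 'X (map_mx polyC B) (map_mx polyC C).
rewrite !expr1n !mul1r mulr1 -!map_mxM => ->.
by rewrite mulrC => /esym.
Qed.

Lemma char_poly_kkt {R : realType} {m n} (a : R) (V : 'M[R]_(m, n)) :
  char_poly (kkt_mx a V) * ('X - a%:P) ^+ m =
  ('X - a%:P) ^+ n * (char_poly (V *m V^T) \Po (('X - a%:P) * 'X)).
Proof.
(* Writing V V^T as (-V)(-V^T) matches the off-diagonal blocks of X - K; the diagonal ones are X - a
   and X. *)
rewrite char_poly_comp map_mxM -[_ *m _]opprK -mulNmx -mulmxN -det_block_scalar_ul.
congr (\det _ * _).
rewrite /char_poly_mx /kkt_mx map_block_mx scalar_mx_block opp_block_mx.
rewrite add_block_mx !add0r map_scalar_mx raddfB /=.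
by rewrite rmorph0 oppr0 addr0.
Qed.

(** * Split characteristic polynomials under scaling and squaring *)

Lemma size_char_poly_roots {P : comNzRingType} {n} (A : 'M[P]_n) (s : seq P) :
  char_poly A = \prod_(x <- s) ('X - x%:P) -> size s = n.
Proof.
by move=> As; apply/succn_inj; rewrite -(size_char_poly A) As size_prod_XsubC.
Qed.

Lemma char_polyZ {F : fieldType} {n} (c : F) (A : 'M[F]_n) (s : seq F) :
  c != 0 -> char_poly A = \prod_(x <- s) ('X - x%:P) ->
  char_poly (c *: A) = \prod_(x <- [seq c * x | x <- s]) ('X - x%:P).
Proof.
move=> c0 As.
have szs : size s = n := size_char_poly_roots _ _ As.
have scaleXK p : (p \Po (c *: 'X)) \Po (c^-1 *: 'X) = p :> {poly F}.
  by rewrite -comp_polyA comp_polyZ comp_polyX scalerA divff // scale1r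
    comp_polyXr.
(* Substituting cX for X is invertible, and afterwards c factors out of each row of cX - cA and out
   of each linear factor. *)
suff /(congr1 (fun p => p \Po (c^-1 *: 'X))) :
  char_poly (c *: A) \Po (c *: 'X) =
  (\prod_(x <- [seq c * x | x <- s]) ('X - x%:P)) \Po (c *: 'X).
  by rewrite !scaleXK.
rewrite char_poly_comp -mul_polyC map_mxZ scalar_mxM mul_scalar_mx -scalerBr.
rewrite detZ -/(char_poly_mx A) -/(char_poly A) As !rmorph_prod.
rewrite big_map -szs; elim: s {As szs} => [|x s IH].
  by rewrite !big_nil mulr1.
rewrite !big_cons /= exprS mulrACA IH; congr (_ * _).
by rewrite comp_polyB comp_polyX comp_polyC mulrBr mul_polyC polyCM.
Qed.

Lemma char_poly_sqr {F : comNzRingType} {n} (A : 'M[F]_n) (s : seq F) :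
  char_poly A = \prod_(x <- s) ('X - x%:P) ->
  char_poly (A *m A) = \prod_(x <- [seq x ^+ 2 | x <- s]) ('X - x%:P).
Proof.
(* X^2 - A^2 = (X - A)(X + A) *)
move=> As.
(* The coefficients of [p] reappear at the even degrees of [p \Po 'X^2]. *)
have compI : injective (fun p : {poly F} => p \Po 'X^2).
  move=> p q pq; apply/polyP => i.
  by have /(congr1 (coefp (i * 2))) := pq;
    rewrite /= !coef_comp_poly_Xn // dvdn_mull // mulnK.
have szs : size s = n := size_char_poly_roots _ _ As.
apply: compI; rewrite char_poly_comp map_mxM.
have -> : 'X^2%:M - map_mx polyC A *m map_mx polyC A =
    char_poly_mx A *m - ((- 'X)%:M - map_mx polyC A).
  rewrite opprB raddfN opprK mulmxDr !mulmxBl -scalar_mxM expr2.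
by rewrite /= mul_scalar_mx mul_mx_scalar [RHS]addrC addrA subrK.
(* Since X + A = -((-X) - A), the second determinant is (-1)^n times [char_poly A] at -X; as [s] has
   n entries, each linear factor absorbs one sign. *)
rewrite det_mulmx -[- (_ - _)]scaleN1r detZ -/(char_poly A) -char_poly_comp As.
rewrite !rmorph_prod big_map -szs; elim: s {As szs} => [|x s IH].
  by rewrite !big_nil expr0 !mulr1.
rewrite !big_cons -IH /= exprS !comp_polyB !comp_polyX !comp_polyC rmorphXn /=.
ring.
Qed.

(** * Eigenvalues and singular values of symmetric matrices *)

Lemma symmetric_char_poly_split {R : rcfType} {n} (A : 'M[R]_n) :
  A^T = A -> exists s : seq R, char_poly A = \prod_(x <- s) ('X - x%:P).
Proof.
(* Over the complex numbers the matrix is Hermitian, so the spectral theorem diagonalizes it with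
   real diagonal entries; injectivity of [f] on polynomials brings the factorization back. *)
move=> Asym; pose f := real_complex R; pose A' := map_mx f A.
have A'real : A' \is a mxOver Num.real.
  by apply/mxOverP => i j; rewrite mxE; apply/complex_realP; exists (A i j).
have A'herm : A' \is hermsymmx.
  apply: realsym_hermsym => //; apply/is_hermitianmxP.
  by rewrite expr0 scale1r map_mx_id // /A' map_trmx Asym.
have /orthomx_spectralP := hermitian_normalmx A'herm.
have := hermitian_spectral_diag_real A'herm.
move: (spectral_diag A') (spectralmx A') (spectral_unit A') =>
  d P Pu /mxOverP dreal.
move=> A'E; exists [seq complex.Re (d 0 i) | i : 'I_n].
apply: (@map_poly_inj _ _ f); rewrite map_char_poly -/A' A'E.
rewrite map_prod_XsubC big_map big_enum /=.
(* Similarity invariance: [char_poly_mulmxC] moves [P] to the front, where it cancels [invmx P]. *)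
have -> : char_poly (invmx P *m diag_mx d *m P) = char_poly (diag_mx d).
  apply: (@mulIf _ 'X^n); first by rewrite expf_neq0 // polyX_eq0.
  by rewrite char_poly_mulmxC mulKVmx // mulrC.
rewrite char_poly_trig ?diag_mx_is_trig //.
apply: eq_bigr => i _; rewrite mxE eqxx mulr1n.
by have := dreal 0 i; case/complex_realP => k ->.
Qed.

(** A split polynomial determines its multiset of roots, and a multiset has only one nonincreasing
    listing, so the choice made by [xget] is forced. *)
Lemma eigvals_sort {R : realType} {n} (A : 'M[R]_n) (s : seq R) :
  char_poly A = \prod_(x <- s) ('X - x%:P) -> eigvals A = sort >=%R s.
Proof.
move=> As; rewrite /eigvals.
case: xgetP => [t _ [tsorted At]|/(_ (sort >=%R s)) []].
  apply: (sorted_eq ge_trans ge_anti) => //.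
    by apply: sort_sorted; exact: ge_total.
  by rewrite perm_sym perm_sort perm_sym; apply: prod_XsubC_eq; rewrite -At.
split; first by apply: sort_sorted; exact: ge_total.
by rewrite As; apply: perm_big; rewrite perm_sym perm_sort.
Qed.

(** Here A^T A = A^2 has the squares x^2 as eigenvalues, and the square root of x^2 is |x|. *)
Lemma singvals_symmetric {R : realType} {n} (A : 'M[R]_n) (s : seq R) :
  A^T = A -> char_poly A = \prod_(x <- s) ('X - x%:P) ->
  singvals A = sort >=%R [seq `|x| | x <- s].
Proof.
move=> Asym As; rewrite /singvals minnn Asym.
rewrite (eigvals_sort _ _ (char_poly_sqr _ _ As)).
have szs : size s = n := size_char_poly_roots _ _ As.
rewrite take_oversize ?size_map ?size_sort ?size_map ?szs //.
apply: (sorted_eq ge_trans ge_anti).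
- rewrite sorted_map; apply: sub_sorted (sort_sorted ge_total _).
  by move=> x y /= xy; exact: ler_wsqrtr.
- exact: sort_sorted ge_total _.
- rewrite perm_sym perm_sort perm_sym.
  apply: (perm_trans (perm_map _ _)); first by rewrite perm_sort.
  by rewrite -map_comp (eq_map (@sqrtr_sqr R)).
Qed.

(** * Gram matrices of matrices with full row rank *)

Lemma gram_eigenvalue_gt0 {R : realType} {m n} (V : 'M[R]_(m, n)) (x : R) :
  row_free V -> root (char_poly (V *m V^T)) x -> 0 < x.
Proof.
move=> Vfree; rewrite -eigenvalue_root_char => /eigenvalueP [u uV u0].
have norm_gt0 p (w : 'rV[R]_p) : w != 0 -> 0 < (w *m w^T) 0 0.
  move=> w0; rewrite mxE lt_def sumr_ge0 ?andbT; last first.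
    by move=> i _; rewrite mxE -expr2 sqr_ge0.
  apply: contra w0; rewrite psumr_eq0; last first.
    by move=> i _; rewrite mxE -expr2 sqr_ge0.
  move=> /allP w0; apply/eqP/rowP => i; rewrite mxE.
  by have := w0 i (mem_index_enum _); rewrite mxE mulf_eq0 orbb => /eqP.
(* For the left eigenvector [u], |uV|^2 = x |u|^2, and both squared norms are positive. *)
have uV0 : u *m V != 0 by rewrite mulmx_free_eq0.
have := norm_gt0 _ _ uV0; rewrite trmx_mul mulmxA -(mulmxA u) uV -scalemxAl mxE.
by rewrite pmulr_lgt0 // norm_gt0.
Qed.

(** [singvals] uses V^T V, whose eigenvalues are those of V V^T and n - m zeros. The former are
    positive, so sorting puts the zeros last and [take] drops exactly them. *)
Lemma singvals_row_free {R : realType} {m n} (V : 'M[R]_(m, n)) (s : seq R) :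
  row_free V -> char_poly (V *m V^T) = \prod_(x <- s) ('X - x%:P) ->
  singvals V = [seq Num.sqrt x | x <- sort >=%R s].
Proof.
move=> Vfree Vs.
have szs : size s = m := size_char_poly_roots _ _ Vs.
have s_gt0 x : x \in s -> 0 < x.
  by move=> xs; apply: gram_eigenvalue_gt0 _ _ Vfree _;
    rewrite Vs root_prod_XsubC.
have mn : (m <= n)%N by rewrite -(eqP Vfree) rank_leq_col.
have VTV : char_poly (V^T *m V) = \prod_(x <- s ++ nseq (n - m) 0) ('X - x%:P).
  apply: (@mulIf _ 'X^m); first by rewrite expf_neq0 // polyX_eq0.
  rewrite char_poly_mulmxC Vs big_cat /= big_nseq -Monoid.iteropE /= subr0.
  by rewrite -mulrA -exprD subnK // mulrC.
rewrite /singvals (minn_idPl mn) (eigvals_sort _ _ VTV).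
have -> : sort >=%R (s ++ nseq (n - m) 0) = sort >=%R s ++ nseq (n - m) 0.
  apply: (sorted_eq ge_trans ge_anti).
  - exact: sort_sorted ge_total _.
  - rewrite (sorted_pairwise ge_trans) pairwise_cat.
    rewrite -!(sorted_pairwise ge_trans).
    rewrite sort_sorted /=; last exact: ge_total.
    apply/andP; split; last first.
      by case: (n - m)%N => // k; elim: k => //= k ->; rewrite lexx.
    apply/allrelP => x y; rewrite mem_sort => /s_gt0 /ltW x_ge0.
    by rewrite mem_nseq => /andP[_ /eqP ->].
  - by rewrite perm_sort perm_cat2r perm_sym perm_sort.
by rewrite map_cat take_size_cat // size_map size_sort.
Qed.

(** * Indexed families and extreme entries of sorted lists *)

Lemma nth_image_map {T1 T2 : Type} {n} (x0 : T1) (g : T1 -> T2) (s : seq T1) :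
  size s = n -> [seq g (nth x0 s j) | j : 'I_n] = [seq g x | x <- s].
Proof.
move=> <-; rewrite -[in RHS](mkseq_nth x0 s) /mkseq -val_enum_ord -map_comp.
by rewrite -map_comp.
Qed.

Lemma sorted_head {R : realDomainType} (s : seq R) (x : R) :
  sorted >=%R s -> x \in s -> {in s, forall y, y <= x} -> head 0 s = x.
Proof.
case: s => //= y s; rewrite (path_sortedE ge_trans) => /andP[/allP ys _].
move=> xs le_x; apply/le_anti; rewrite le_x ?mem_head //=.
by move: xs; rewrite inE => /predU1P[->//|/ys].
Qed.

Lemma sorted_last {R : realDomainType} (s : seq R) (x : R) :
  sorted >=%R s -> x \in s -> {in s, forall y, x <= y} -> last 0 s = x.
Proof.
case: (lastP s) => // {}s y; rewrite last_rcons -rev_sorted rev_rcons /=.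
rewrite path_sortedE; last by move=> a b c; exact: le_trans.
move=> /andP[/allP ys _]; rewrite mem_rcons => xs le_x.
apply/le_anti; rewrite le_x ?mem_rcons ?mem_head // andbT.
by move: xs; rewrite inE => /predU1P[->//|]; rewrite -mem_rev => /ys.
Qed.

(** * Linear factors of the KKT characteristic polynomial *)

Lemma char_poly_kkt_split {R : realType} {m n} (a : R) (V : 'M[R]_(m, n))
    (s : seq R) :
  (m <= n)%N -> char_poly (V *m V^T) = \prod_(x <- s) ('X - x%:P) ->
  {in s, forall x, 0 <= x} ->
  char_poly (kkt_mx a V) =
  \prod_(x <- nseq (n - m) a ++
      ([seq (a + Num.sqrt (a ^+ 2 + 4 * x)) / 2 | x <- s] ++
       [seq (a - Num.sqrt (a ^+ 2 + 4 * x)) / 2 | x <- s])) ('X - x%:P).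
Proof.
move=> mn Vs s_ge0; apply: (@mulIf _ (('X - a%:P) ^+ m)).
  by rewrite expf_neq0 // polyXsubC_eq0.
rewrite char_poly_kkt Vs rmorph_prod big_cat big_nseq -Monoid.iteropE /=.
rewrite [RHS]mulrAC -exprD subnK //; congr (_ * _).
rewrite big_cat /= !big_map -big_split /=.
rewrite !big_seq; apply: eq_bigr => x /s_ge0 x_ge0.
rewrite comp_polyB comp_polyX comp_polyC.
set d := Num.sqrt _.
have d2 : d ^+ 2 = a ^+ 2 + 4 * x.
  by rewrite sqr_sqrtr // addr_ge0 ?sqr_ge0 // mulr_ge0.
(* Vieta: p + q = a and pq = -x, hence (X - a)X - x = (X - p)(X - q). *)
pose p := (a + d) / 2; pose q := (a - d) / 2.
have aE : a = p + q by rewrite /p /q; field.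
have xE : x = - (p * q).
  have -> : x = (d ^+ 2 - a ^+ 2) / 4 by rewrite d2; field.
  by rewrite /p /q; field.
by rewrite -/p -/q xE (congr1 polyC aE) polyCN polyCM polyCD; ring.
Qed.

(** * Spectrum, singular values and condition number of the KKT matrix *)

Theorem theorem8 (R : realType) (m r n k : nat)
    (XN : 'I_(n.+1 ^ 2) -> 'rV[R]_3) (XM : 'I_(m.+1 ^ 2) -> 'rV[R]_3)
    (hmr : (m < r)%N) (hrn : (r < n)%N) (hk : (2 * r <= k)%N)
    (XN_sphere : forall i, sphere2 (XN i)) (XN_inj : injective XN)
    (XN_design : spherical_design k XN)
    (XM_inj : injective XM) (XM_sub : forall j, exists i, XM j = XN i)
    (XM_rank : \rank (vandermonde r XM) = (m.+1 ^ 2)%N) :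
  let N := (n.+1 ^ 2)%N in
  let M := (m.+1 ^ 2)%N in
  let dimR := (r.+1 ^ 2)%N in
  let alpha : R := N%:R / (4 * pi) in
  let V := vandermonde r XM in
  let sigma := singvals V in
  let S := alpha^-1 *: (V *m V^T) in
  let mu := eigvals S in
  let K := kkt_mx alpha V in
  let lambda_p (j : 'I_M) :=
    (alpha + Num.sqrt (alpha ^+ 2 + 4 * alpha * mu`_j)) / 2 in
  let lambda_m (j : 'I_M) :=
    (alpha - Num.sqrt (alpha ^+ 2 + 4 * alpha * mu`_j)) / 2 in
  [/\ (* the singular values of V are sigma_1 >= ... >= sigma_M > 0, and S has
         M eigenvalues *)
      [/\ size sigma = M,
          (forall i j : 'I_M, (i <= j)%N -> sigma`_j <= sigma`_i),
          0 < sigma`_M.-1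
        & size mu = M],
      (* (i) *)
      perm_eq (eigvals K)
        (nseq (dimR - M) alpha ++
         ([seq lambda_p j | j : 'I_M] ++ [seq lambda_m j | j : 'I_M]))
      /\ (forall j : 'I_M, 0 < lambda_p j /\ lambda_m j < 0),
      (* (ii) *)
      perm_eq (singvals K)
        (nseq (dimR - M) alpha ++
         ([seq (alpha + Num.sqrt (alpha ^+ 2 + 4 * sigma`_j ^+ 2)) / 2
            | j : 'I_M] ++
          [seq (Num.sqrt (alpha ^+ 2 + 4 * sigma`_j ^+ 2) - alpha) / 2
            | j : 'I_M]))
    & (* (iii) *)
      cond2 K =
        ((alpha + Num.sqrt (alpha ^+ 2 + 4 * sigma`_0 ^+ 2)) / 2) /
        Num.min alpha
          ((Num.sqrt (alpha ^+ 2 + 4 * sigma`_M.-1 ^+ 2) - alpha) / 2)].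
Proof.
move=> N M dimR alpha V sigma S mu K lambda_p lambda_m.
have alpha_gt0 : 0 < alpha.
  by rewrite divr_gt0 ?mulr_gt0 ?pi_gt0 ?ltr0n // /N expn_gt0.
have M_gt0 : (0 < M)%N by rewrite expn_gt0.
have M_lt : (M < dimR)%N by rewrite ltn_exp2r.
have Vfree : row_free V by rewrite /row_free XM_rank.
have sortP (s : seq R) : sorted >=%R (sort >=%R s).
  by apply: sort_sorted; exact: ge_total.
have [t St] : exists t : seq R, char_poly S = \prod_(x <- t) ('X - x%:P).
  apply: symmetric_char_poly_split.
  by rewrite /S linearZ /= trmx_mul trmxK.
have muE : mu = sort >=%R t by exact: eigvals_sort St.
have mu_sorted : sorted >=%R mu by rewrite muE.
have Smu : char_poly S = \prod_(x <- mu) ('X - x%:P).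
  by rewrite St muE; apply: perm_big; rewrite perm_sym perm_sort.
have szmu : size mu = M := size_char_poly_roots _ _ Smu.
(* As V V^T = alpha S, its eigenvalues are the alpha mu_j. Scaling by alpha > 0 keeps the order, so
   sigma_j^2 = alpha mu_j holds index by index. *)
have VVs : char_poly (V *m V^T) =
    \prod_(x <- [seq alpha * x | x <- mu]) ('X - x%:P).
  have alpha0 : alpha != 0 by rewrite gt_eqF.
  by rewrite -(char_polyZ alpha _ _ alpha0 Smu) /S scalerA divff // scale1r.
have amu_gt0 x : x \in mu -> 0 < alpha * x.
  move=> xmu; apply: gram_eigenvalue_gt0 _ _ Vfree _.
  by rewrite VVs root_prod_XsubC map_f.
have sigmaE : sigma = [seq Num.sqrt (alpha * x) | x <- mu].
  rewrite /sigma (singvals_row_free _ _ Vfree VVs) sorted_sort -?map_comp //.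
    exact: ge_trans.
  rewrite sorted_map; apply: sub_sorted mu_sorted => x y /= xy.
  by rewrite ler_pM2l.
have szsigma : size sigma = M by rewrite sigmaE size_map.
have sigma_sorted : sorted >=%R sigma.
  rewrite sigmaE sorted_map; apply: sub_sorted mu_sorted => x y /= xy.
  by rewrite ler_wsqrtr // ler_pM2l.
have sigma_gt0 x : x \in sigma -> 0 < x.
  by rewrite sigmaE => /mapP[y /amu_gt0 y_gt0 ->]; rewrite sqrtr_gt0.
have sigma_mono i j : (i <= j)%N -> (j < M)%N -> sigma`_j <= sigma`_i.
  move=> ij jM; apply: (sorted_leq_nth ge_trans ge_refl 0 sigma_sorted) => //;
    by rewrite inE szsigma // (leq_ltn_trans ij).
(* The eigenvalues in terms of a singular value x of [V] are [root_p x] and [- root_m x]; they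
   satisfy [root_p x - root_m x = alpha]. *)
pose root_p (x : R) : R := (alpha + Num.sqrt (alpha ^+ 2 + 4 * x ^+ 2)) / 2.
pose root_m (x : R) : R := (Num.sqrt (alpha ^+ 2 + 4 * x ^+ 2) - alpha) / 2.
have root_m_gt0 (x : R) : 0 < x -> 0 < root_m x.
  move=> x0; rewrite divr_gt0 // subr_gt0.
  rewrite -[ltLHS](gtr0_norm alpha_gt0) -sqrtr_sqr ltr_sqrt.
    by rewrite ltrDl mulr_gt0 // exprn_gt0.
  by rewrite ltr_wpDl ?sqr_ge0 // mulr_gt0 // exprn_gt0.
have root_p_gt0 x : 0 < root_p x.
  by rewrite divr_gt0 // ltr_wpDr // sqrtr_ge0.
have sqrt_mono (x y : R) : 0 <= x <= y ->
    Num.sqrt (alpha ^+ 2 + 4 * x ^+ 2) <= Num.sqrt (alpha ^+ 2 + 4 * y ^+ 2).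
  move=> /andP[x0 xy]; rewrite ler_wsqrtr // lerD2l ler_pM2l //.
  by rewrite lerXn2r // nnegrE // (le_trans x0).
have Kchar : char_poly K = \prod_(x <- nseq (dimR - M) alpha ++
    ([seq root_p x | x <- sigma] ++ [seq - root_m x | x <- sigma])) ('X - x%:P).
  rewrite (char_poly_kkt_split alpha _ _ (ltnW M_lt) VVs); last first.
    by move=> _ /mapP[x /amu_gt0 /ltW x_ge0 ->].
  rewrite sigmaE -!map_comp; congr (\prod_(x <- _ ++ (_ ++ _)) _);
    apply/eq_in_map => x /amu_gt0 /ltW x_ge0 /=;
    by rewrite /root_p /root_m ?sqr_sqrtr // -mulNr opprB.
have Ksym : K^T = K.
  by rewrite /K /kkt_mx tr_block_mx trmxK tr_scalar_mx trmx0.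
(* Taking absolute values changes only the negative eigenvalues [- root_m x]. *)
have singK : perm_eq (singvals K) (nseq (dimR - M) alpha ++
    ([seq root_p x | x <- sigma] ++ [seq root_m x | x <- sigma])).
  rewrite (singvals_symmetric _ _ Ksym Kchar) perm_sort !map_cat map_nseq.
  rewrite gtr0_norm // -!map_comp; apply/permP => p;
    congr (count p (_ ++ (_ ++ _)));
    apply/eq_in_map => x /sigma_gt0 x_gt0 /=; rewrite ?normrN gtr0_norm //.
  exact: root_m_gt0.
have sing_sorted : sorted >=%R (singvals K).
  by rewrite (singvals_symmetric _ _ Ksym Kchar).
have sigma0 : sigma`_0 \in sigma by rewrite mem_nth ?szsigma.
have sigmaM : sigma`_M.-1 \in sigma by rewrite mem_nth ?szsigma ?prednK.
(* With indices from 0, the largest singular value has index 0 and the smallest index M - 1. *)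
have sigma_bounds x : x \in sigma -> sigma`_M.-1 <= x <= sigma`_0.
  case/(nthP (0 : R)) => i; rewrite szsigma => iM <-.
  by rewrite !sigma_mono // -?ltnS ?prednK.
have lambda_pE j : lambda_p j = root_p sigma`_j.
  have jmu : mu`_j \in mu by rewrite mem_nth ?szmu.
  rewrite /root_p sigmaE (nth_map 0) ?szmu // sqr_sqrtr ?(ltW (amu_gt0 _ _)) //.
  by rewrite mulrA.
have lambda_mE j : lambda_m j = - root_m sigma`_j.
  have jmu : mu`_j \in mu by rewrite mem_nth ?szmu.
  rewrite /root_m sigmaE (nth_map 0) ?szmu // sqr_sqrtr ?(ltW (amu_gt0 _ _)) //.
  by rewrite mulrA -mulNr opprB.
split.
- split=> //; last by apply: sigma_gt0.
  by move=> i j ij; apply: sigma_mono.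
- split.
    rewrite (eigvals_sort _ _ Kchar) perm_sort.
    rewrite (eq_image (frefl _) lambda_pE) (eq_image (frefl _) lambda_mE).
    by rewrite (nth_image_map 0 root_p) //
      (nth_image_map 0 (fun x => - root_m x)).
  by move=> j; rewrite lambda_pE lambda_mE oppr_lt0 root_p_gt0 root_m_gt0
    ?sigma_gt0 ?mem_nth ?szsigma.
- rewrite (nth_image_map 0 root_p) // (nth_image_map 0 root_m) //.
- rewrite /cond2 -/(root_p _) -/(root_m _); congr (_ / _).
    (* The maximum is [root_p] at the largest sigma: it exceeds alpha by [root_m] there, and both
       root functions increase with sigma. *)
    apply: sorted_head => //.
      by rewrite (perm_mem singK) !mem_cat map_f ?orbT.
    move=> x; rewrite (perm_mem singK) !mem_cat mem_nseq.
    case/or3P=> [/andP[_ /eqP ->]|/mapP[y ys ->]|/mapP[y ys ->]].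
    + have := root_m_gt0 _ (sigma_gt0 _ sigma0); rewrite /root_m /root_p; lra.
    + have := sqrt_mono y sigma`_0; rewrite (ltW (sigma_gt0 _ ys)).
      by have /andP[_ -> /(_ isT)] := sigma_bounds _ ys;
        rewrite /root_m /root_p; lra.
    + have := sqrt_mono y sigma`_0; rewrite (ltW (sigma_gt0 _ ys)).
      by have /andP[_ -> /(_ isT)] := sigma_bounds _ ys;
        rewrite /root_m /root_p; lra.
  apply: sorted_last => //.
    (* Since M < R strictly, alpha occurs in the list, so the minimum is attained whichever argument
       is smaller. *)
    rewrite (perm_mem singK) !mem_cat mem_nseq subn_gt0 M_lt /=.
    by case: leP => _; rewrite ?eqxx // map_f ?orbT.
  move=> x; rewrite (perm_mem singK) !mem_cat mem_nseq ge_min.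
  case/or3P=> [/andP[_ /eqP ->]|/mapP[y ys ->]|/mapP[y ys ->]].
  + by rewrite lexx.
  (* Each [root_p y] equals alpha + [root_m y], hence exceeds alpha. *)
  + by apply/orP; left; have := root_m_gt0 _ (sigma_gt0 _ ys);
      rewrite /root_m /root_p; lra.
  + apply/orP; right; have := sqrt_mono sigma`_M.-1 y.
    rewrite (ltW (sigma_gt0 _ sigmaM)).
    by have /andP[-> _ /(_ isT)] := sigma_bounds _ ys;
        rewrite /root_m /root_p; lra.
Qed.
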